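(* Let $G$ be a minimally $2$-connected graph of order $n\ge 3$. Then \[1\le \bar{\kappa}_{\max}(G)\le 1+\frac{(n-3)^2}{4n(n-1)}<\frac{5}{4}.\]
   Context: Graphs are finite and simple. A graph $G$ is minimally $2$-connected if it is $2$-connected and $G-e$ is not $2$-connected for every edge $e$. An orientation of $G$ is a digraph obtained by directing every edge. For a digraph $D$ and distinct vertices $u,v$, $\kappa_D(u,v)$ is the maximum number of internally disjoint directed $u$--$v$ paths. For a digraph $D$ of order $n$, $\bar{\kappa}(D)=\frac{1}{n(n-1)}\sum_{(u,v)}\kappa_D(u,v)$ over all ordered pairs of distinct vertices; $\bar{\kappa}_{\max}(G)$ is the maximum of $\bar{\kappa}(D)$ over all orientations $D$ of $G$. *)

(* Defs.v *)
From HB Require Import structures.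
From mathcomp Require Import all_boot all_order all_algebra.

Set Implicit Arguments.
Unset Strict Implicit.
Unset Printing Implicit Defensive.

Import Order.TTheory GRing.Theory Num.Theory.
Local Open Scope ring_scope.

(* A finite simple graph is a symmetric irreflexive relation on a finType; a
   digraph is its set of arcs, so that digraphs on T form a finType. *)

Section Graphs.

Variable T : finType.
Implicit Types (e : rel T) (D : {set T * T}) (u v x y : T).

Definition simple_graph e : Prop := symmetric e /\ irreflexive e.

Definition del_vertices e (S : {set T}) : rel T :=
  [rel a b | [&& e a b, a \notin S & b \notin S]].

Definition del_edge e x y : rel T :=
  [rel a b | e a b && ([set a; b] != [set x; y])].

Definition k_connected (k : nat) e : Prop :=
  (k < #|T|)%N /\
  forall S : {set T}, (#|S| < k)%N ->
    forall x y, x \notin S -> y \notin S -> connect (del_vertices e S) x y.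

Definition minimally_2_connected e : Prop :=
  k_connected 2 e /\ forall x y, e x y -> ~ k_connected 2 (del_edge e x y).

Definition arc D : rel T := [rel x y | (x, y) \in D].

Definition orientation e : pred {set T * T} :=
  fun D => [forall x, forall y,
    if e x y then arc D x y (+) arc D y x else ~~ arc D x y].

(* The path u :: p is represented by its tail p. *)
Definition dipath D u v (p : seq T) : bool :=
  [&& path (arc D) u p, last u p == v & uniq (u :: p)].

Definition internal u (p : seq T) : seq T := behead (belast u p).

(* A tail of a path has fewer than #|T| vertices, so bounding its size by #|T|
   loses nothing and makes the families of paths a finType. *)
Definition internally_disjoint_paths D u v : pred {set #|T|.-bseq T} :=
  fun F => [forall p in F, dipath D u v p] &&
    [forall p in F, forall q in F,
       (p != q) ==> ~~ has [in internal u p] (internal u q)].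

Definition kappa D u v : nat :=
  (\max_(F : {set #|T|.-bseq T} | internally_disjoint_paths D u v F) #|F|)%N.

Definition avg_kappa D : rat :=
  (\sum_(uv : T * T | uv.1 != uv.2) kappa D uv.1 uv.2)%N%:R
    / (#|T|%:R * (#|T|%:R - 1)).

(* Since avg_kappa is nonnegative and every simple graph has an orientation, the
   default value 0 does not affect this maximum; see max_avg_kappaP. *)
Definition max_avg_kappa e : rat :=
  \big[Num.max/0]_(D : {set T * T} | orientation e D) avg_kappa D.

Lemma avg_kappa_ge0 D : 0 <= avg_kappa D.
Proof.
apply: divr_ge0; first exact: ler0n.
case: #|T| => [|n]; first by rewrite mul0r.
by rewrite -natr1 addrK mulr_ge0 // ?natr1 ler0n.
Qed.

Lemma orientation_exists e : simple_graph e -> exists D, orientation e D.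
Proof.
case=> sym irr.
exists [set xy | e xy.1 xy.2 && (enum_rank xy.1 < enum_rank xy.2)%N].
apply/forallP => x; apply/forallP => y; rewrite /arc /= !inE /= (sym y x).
case: ifP => exy; rewrite ?exy //=.
case: (ltngtP (enum_rank x) (enum_rank y)) => // eqr.
by move: exy; rewrite (enum_rank_inj (ord_inj eqr)) irr.
Qed.

Lemma max_avg_kappaP e : simple_graph e ->
  (exists2 D, orientation e D & avg_kappa D = max_avg_kappa e) /\
  (forall D, orientation e D -> avg_kappa D <= max_avg_kappa e).
Proof.
move=> /orientation_exists [D0 D0e]; split; last first.
  by move=> D De; rewrite /max_avg_kappa (bigD1 D) //= le_max lexx.
case: (arg_maxP avg_kappa D0e) => D De Dmax; exists D => //.
apply/le_anti/andP; split.
  by rewrite /max_avg_kappa (bigD1 D) //= le_max lexx.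
rewrite /max_avg_kappa; elim/big_ind: _.
- exact: avg_kappa_ge0.
- by move=> x y xD yD; rewrite ge_max xD.
- by move=> D' D'e; apply: Dmax.
Qed.

End Graphs.

(* Main.v *)
(** Lower bound: among the strongly connected arc sets that contain every edge
    in at least one direction, a minimal one is an orientation (Robbins), and
    there every ordered pair has kappa at least 1.

    Upper bound: let F be the set of vertices of degree at least 3, and f its
    size. Every remaining vertex has degree 2. Since kappa(u,v) is at most the
    outdegree of u and the indegree of v, kappa(u,v) + kappa(v,u) is at most 2
    if u or v is outside F and at most (deg u + deg v) / 2 in any case.
    Summing, the excess over n(n-1) is at most (f-1)/2 times the sum of
    deg x - 2 over F. Minimality gives, for each edge uv, a vertex c that
    separates u from v in G - uv; following edges of F the sides of these
    separations shrink, so F induces a forest, and if it induces a tree then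
    two vertices of degree 2 are adjacent. Counting edges then bounds the sum
    by 2(n-f-2), and (f-1)(n-f-2) <= (n-3)^2/4. *)

Require Import Defs.
From HB Require Import structures.
From mathcomp Require Import all_boot all_order all_algebra zify ring lra.
(* The [arc] of a digraph is shadowed by [path.arc] otherwise. *)
Import Defs.

Set Implicit Arguments.
Unset Strict Implicit.
Unset Printing Implicit Defensive.

(** * Edges leaving a vertex set in a 2-connected graph *)

Lemma connect_exit (T : finType) (r : rel T) (A : {set T}) (x y : T) :
  connect r x y -> x \in A -> y \notin A ->
  exists a b, [/\ a \in A, b \notin A & r a b].
Proof.
case/connectP => p; elim: p x => [|z p IHp] x /=; first by move=> _ -> ->.
case/andP=> rxz pz yE xA yA.
by case: (boolP (z \in A)) => zA; [exact: IHp zA yA | exists x, z].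
Qed.

(** The exit is taken along a path that avoids [c]. Most later contradictions delete a well-chosen
    [c] and find no possible exit edge. *)
Lemma exit_edge (T : finType) (e : rel T) (c x y : T) (A : {set T}) :
  k_connected 2 e -> c \notin A -> x \in A -> y \notin A -> y != c ->
  exists a b, [/\ a \in A, b \notin A, b != c & e a b].
Proof.
move=> [_ conn] cA xA yA yc.
have xc : x != c by apply: contraNneq cA => <-.
have := conn [set c]; rewrite cards1 => /(_ isT x y).
rewrite !inE => /(_ xc yc) /connect_exit /(_ xA yA) [a [b [aA bA]]].
by rewrite /del_vertices /= !inE => /and3P[eab _ bc]; exists a, b.
Qed.

Lemma third_vertex (T : finType) (u v : T) :
  2 < #|T| -> exists w, (w != u) && (w != v).
Proof.
move=> n3; have : 0 < #|~: [set u; v]|.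
  have := cardsC [set u; v]; have : #|[set u; v]| <= 2 by rewrite cards2; case: eqP.
  by lia.
by case/card_gt0P => w; rewrite !inE negb_or => ?; exists w.
Qed.

(** A third vertex lies on one side of the bridge; deleting the end of the bridge on that side would
    cut this vertex off from the other end. *)
Lemma connected2_no_bridge (T : finType) (e : rel T) (u v : T) (U : {set T}) :
  symmetric e -> k_connected 2 e -> u \in U -> v \notin U ->
  (forall x y, x \in U -> y \notin U -> e x y -> x = u /\ y = v) -> False.
Proof.
move=> esym conn uU vU bridge.
have vu : v != u by apply: contraNneq vU => ->.
have [w /andP[wu wv]] := third_vertex u v conn.1.
case: (boolP (w \in U)) => wU.
- have [||||a [b []]] := @exit_edge _ e u w v (U :\ u) conn;
    rewrite ?inE ?wu ?eqxx ?wU ?(negPf vU) ?andbF //.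
  case/andP=> au aU; rewrite negb_and negbK => /orP[/eqP->|bU _ eab];
    first by rewrite eqxx.
  by have [aE _] := bridge _ _ aU bU eab; rewrite aE eqxx in au.
- have [||||a [b []]] := @exit_edge _ e v w u (~: U :\ v) conn;
    rewrite ?inE ?wv ?eqxx ?wU ?uU ?andbF // 1?eq_sym //.
  case/andP=> av aU; rewrite negb_and !negbK => /orP[/eqP->|bU _ eab];
    first by rewrite eqxx.
  by have [_ aE] := bridge _ _ bU aU (etrans (esym _ _) eab); rewrite aE eqxx in av.
Qed.

(** * Strong orientations *)

Definition strong (T : finType) (H : {set T * T}) : Prop :=
  forall x y, connect (arc H) x y.

Lemma strongD1 (T : finType) (H : {set T * T}) (u v : T) :
  strong H -> connect (arc (H :\ (u, v))) u v -> strong (H :\ (u, v)).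
Proof.
move=> sH cuv x y; apply: connect_sub (sH x y) => a b Hab.
have [[-> ->]//|abuv] := eqVneq (a, b) (u, v).
by apply: connect1; rewrite /arc /= !inE abuv.
Qed.

(* If neither arc can be dropped, the sets reached from [u] and from [v]
   without it partition the vertices, and [uv] is a bridge. *)
Lemma strong_unidirect (T : finType) (e : rel T) (H : {set T * T}) (u v : T) :
  symmetric e -> k_connected 2 e ->
  (forall x y, e x y -> arc H x y || arc H y x) ->
  strong H -> u != v -> strong (H :\ (u, v)) \/ strong (H :\ (v, u)).
Proof.
move=> esym conn cover sH uv.
case: (boolP (connect (arc (H :\ (u, v))) u v)) => [|nuv]; first by left;
  apply: strongD1.
case: (boolP (connect (arc (H :\ (v, u))) v u)) => [|nvu]; first by right;
  apply: strongD1.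
exfalso.
set U := [set x | connect (arc (H :\ (u, v))) u x].
set V := [set x | connect (arc (H :\ (v, u))) v x].
have uU : u \in U by rewrite inE.
have vV : v \in V by rewrite inE.
have vU : v \notin U by rewrite inE.
have uV : u \notin V by rewrite inE.
have outU x y : x \in U -> y \notin U -> arc H x y -> x = u /\ y = v.
  rewrite !inE => ux uy Hxy; case: (eqVneq (x, y) (u, v)) => [[]//|nxy].
  by case/negP: uy; apply: connect_trans ux (connect1 _); rewrite /arc /= !inE nxy.
have outV x y : x \in V -> y \notin V -> arc H x y -> x = v /\ y = u.
  rewrite !inE => ux uy Hxy; case: (eqVneq (x, y) (v, u)) => [[]//|nxy].
  by case/negP: uy; apply: connect_trans ux (connect1 _); rewrite /arc /= !inE nxy.
clearbody U V.
(* A walk from a common vertex to [u] leaves [U :&: V], but an arc out of [U] starts at [u], outside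
   [V], and an arc out of [V] starts at [v], outside [U]. *)
have disj x : x \in U -> x \in V -> False.
  move=> xU xV.
  have [||a [b []]] := @connect_exit _ _ (U :&: V) x u (sH x u);
    rewrite ?inE ?xU ?(negPf uV) ?andbF //.
  case/andP=> aU aV; rewrite negb_and => /orP[bU|bV] Hab.
    by have [aE _] := outU _ _ aU bU Hab; rewrite -aE aV in uV.
  by have [aE _] := outV _ _ aV bV Hab; rewrite -aE aU in vU.
(* An arc out of [U] ends at [v], in [V], and an arc out of [V] ends at [u], in [U], so no arc
   leaves the union. *)
have cov x : (x \in V) = (x \notin U).
  apply/idP/idP => [xV|xU]; first by apply/negP => /disj; apply.
  apply/negPn/negP => xV.
  have [||a [b []]] := @connect_exit _ _ (U :|: V) u x (sH u x);
    rewrite ?inE ?uU ?negb_or ?xU //.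
  move=> aUV /andP[bU bV] Hab; case/orP: aUV => [aU|aV].
    by have [_ bE] := outU _ _ aU bU Hab; rewrite bE vV in bV.
  by have [_ bE] := outV _ _ aV bV Hab; rewrite bE uU in bU.
apply: (connected2_no_bridge esym conn uU vU) => x y xU yU /cover /orP[];
  first exact: outU.
rewrite -cov in yU; have xV : x \notin V by rewrite cov xU.
by move=> /(outV _ _ yU xV) [].
Qed.

(** Starting from both arcs on every edge, [strong_unidirect] drops one arc of a two-way pair at a
    time until no such pair is left. *)
Lemma strong_orientation (T : finType) (e : rel T) :
  simple_graph e -> k_connected 2 e -> exists2 D, orientation e D & strong D.
Proof.
move=> [esym eirr] conn.
have esub H : (forall x y, e x y -> arc H x y || arc H y x) ->
    (forall x y, arc H x y -> e x y) -> strong H ->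
    exists2 D, orientation e D & strong D.
  have [k] := ubnP #|H|; elim: k H => // k IHk H Hk cover Hsub sH.
  case: (boolP [exists u, exists v, arc H u v && arc H v u]); last first.
    move=> noboth; exists H => //; apply/forallP => x; apply/forallP => y.
    case: ifP => [exy|/negbT nexy]; last by apply: contra nexy; apply: Hsub.
    move: (cover _ _ exy) noboth; case Hxy: (arc H x y);
      case Hyx: (arc H y x) => // _.
    by case/existsP; exists x; apply/existsP; exists y; rewrite Hxy Hyx.
  case/existsP => u /existsP[v /andP[Huv Hvu]].
  have uv : u != v by apply/eqP => uv; have := Hsub _ _ Huv; rewrite uv eirr.
  have step a b : a != b -> arc H a b -> arc H b a -> strong (H :\ (a, b)) ->
      exists2 D, orientation e D & strong D.
    move=> ab Hab Hba; apply: IHk.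
    - by move: Hk; rewrite ltnS; apply: leq_trans;
        rewrite [X in _ <= X](cardsD1 (a, b)) (Hab : (a, b) \in H).
    - move=> x y /cover; rewrite /arc /= !inE.
      case: (eqVneq (x, y) (a, b)) => [[-> ->] _|_] /=.
        by rewrite (Hba : (b, a) \in H) xpair_eqE negb_and ab orbT.
      case/orP => [->//|Hyx]; rewrite Hyx andbT orbC.
      case: (eqVneq (y, x) (a, b)) => [[-> ->]|//] /=.
      exact: Hba.
    - by move=> x y; rewrite /arc /= !inE => /andP[_]; apply: Hsub.
  have [] := strong_unidirect esym conn cover sH uv; first exact: step.
  by apply: step => //; rewrite eq_sym.
pose H0 := [set xy | e xy.1 xy.2].
have arcH0 : arc H0 =2 e by move=> x y; rewrite /arc /= inE.
apply: (esub H0) => [x y|x y|x y]; rewrite ?arcH0 //; first by move->.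
rewrite (eq_connect arcH0); have := conn.2 set0; rewrite cards0 => /(_ isT x y).
rewrite !inE => /(_ isT isT); apply: connect_sub => a b /and3P[eab _ _].
exact: connect1.
Qed.

(** * Local connectivity and degrees *)

Lemma kappa_gt0 (T : finType) (D : {set T * T}) (u v : T) :
  connect (arc D) u v -> 0 < kappa D u v.
Proof.
case/connectP => p0 pp0 ->; case/shortenP: pp0 => p pp up _.
have sp : size p <= #|T|.
  by have := max_card [in u :: p]; rewrite (card_uniqP up); apply: leq_trans.
pose F := [set Bseq sp].
suff HF : internally_disjoint_paths D u (last u p) F.
  by apply: (leq_trans _ (leq_bigmax_cond F HF)); rewrite cards1.
apply/andP; split; first by apply/forall_inP => q /set1P ->;
  rewrite /dipath /= pp eqxx.
by apply/forall_inP => q /set1P ->; apply/forall_inP => r /set1P ->; rewrite eqxx.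
Qed.

Definition outdeg (T : finType) (D : {set T * T}) (u : T) := #|[set w | arc D u w]|.
Definition indeg (T : finType) (D : {set T * T}) (v : T) := #|[set w | arc D w v]|.
Definition deg (T : finType) (e : rel T) (x : T) := #|[set y | e x y]|.

(** The conditions make [h] injective on any internally disjoint family. It is applied with the
    second and with the second-to-last vertex of the path. *)
Lemma kappa_le_card (T : finType) (D : {set T * T}) (u v : T) (A : {set T})
    (h : #|T|.-bseq T -> T) :
  (forall p : #|T|.-bseq T, dipath D u v p -> h p \in A) ->
  (forall p q : #|T|.-bseq T, dipath D u v p -> dipath D u v q -> h p = h q -> p != q ->
     has [in internal u p] (internal u q)) ->
  kappa D u v <= #|A|.
Proof.
move=> hA hinj; apply/bigmax_leqP => F /andP[/forall_inP Fpath /forall_inP Fdisj].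
rewrite -(@card_in_imset _ _ h).
  by apply/subset_leq_card/subsetP => _ /imsetP[p pF ->]; apply/hA/Fpath.
move=> p q pF qF hpq; apply/eqP/negPn/negP => pq.
have /forall_inP/(_ q qF)/implyP/(_ pq)/negP := Fdisj p pF; apply.
exact: hinj (Fpath _ pF) (Fpath _ qF) hpq pq.
Qed.

Lemma kappa_le_outdeg (T : finType) (D : {set T * T}) (u v : T) :
  u != v -> kappa D u v <= outdeg D u.
Proof.
move=> uv; apply: (@kappa_le_card _ D u v _ (fun p => head u p)).
  move=> [[|h p] /= sp]; rewrite /dipath /=; first by rewrite (negPf uv).
  by rewrite inE; case/and3P => /andP[].
move=> [[|h p] /= sp] [[|h' q] /= sq]; rewrite /dipath /= ?(negPf uv) //.
case/and3P => _ pv pu /and3P[_ qv qu] hh; subst h'; rewrite -val_eqE /=.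
rewrite eqseq_cons eqxx /= /internal /=.
(* If exactly one path is a single arc, the common first vertex is [v], which the longer path would
   repeat at its end. If both are longer, that vertex is internal to both. *)
case: p {sp} pv pu => [|a p] /= pv pu; case: q {sq} qv qu => [|b q] /= qv qu //.
- by move: qu; rewrite (eqP pv) -(eqP qv) mem_last andbF.
- by move: pu; rewrite (eqP qv) -(eqP pv) mem_last andbF.
- by rewrite !inE eqxx.
Qed.

Lemma kappa_le_indeg (T : finType) (D : {set T * T}) (u v : T) :
  u != v -> kappa D u v <= indeg D v.
Proof.
(* [last u (belast u p)] is the vertex just before the end of [u :: p]. *)
move=> uv; apply: (@kappa_le_card _ D u v _ (fun p => last u (belast u p))).
  move=> [p /= _]; case/lastP: p => [|p z]; rewrite /dipath /=;
    first by rewrite (negPf uv).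
  rewrite belast_rcons last_rcons rcons_path /= inE.
  by case/and3P => /andP[_ ?] /eqP <-.
move=> [p /= sp] [q /= sq]; rewrite -val_eqE /= {sp sq}.
case/lastP: p => [|p z]; rewrite /dipath /= ?(negPf uv) //.
case/lastP: q => [|q z']; rewrite /= ?(negPf uv) //.
rewrite !last_rcons /internal !belast_rcons /= => /and3P[_ /eqP-> pu] /and3P[_ /eqP-> qu] pq.
rewrite eqseq_rcons eqxx andbT.
case: p pu pq => [|a p] pu; case: q qu => [|b q] qu //= pq.
- by move: qu; rewrite /= -rcons_cons mem_rcons in_cons pq mem_last orbT.
- by move: pu; rewrite /= -rcons_cons mem_rcons in_cons -pq mem_last orbT.
- by move=> _; apply/(@hasP _ _ (b :: q)); exists (last b q); [|rewrite -pq];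
    exact: mem_last.
Qed.

Lemma orientation_degree (T : finType) (e : rel T) (D : {set T * T}) (u : T) :
  symmetric e -> orientation e D -> outdeg D u + indeg D u = deg e u.
Proof.
move=> esym /forallP De; rewrite /outdeg /indeg /deg -cardsUI.
have step w := (forallP (De u) w, forallP (De w) u).
have -> : [set w | arc D u w] :&: [set w | arc D w u] = set0.
  by apply/setP => w; rewrite !inE; case: (step w); rewrite (esym w); case: ifP;
    case: (arc D u w); case: (arc D w u).
rewrite cards0 addn0; apply: eq_card => w; rewrite !inE.
by case: (step w); rewrite (esym w); case: ifP; case: (arc D u w);
  case: (arc D w u).
Qed.

(** * Separations across an edge *)

(* Deleting the edge [uv] and the vertex [c] leaves no edge from [X] to the
   rest of the graph. *)
Definition edge_sep (T : finType) (e : rel T) (u v : T) (X : {set T}) (c : T) :=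
  [/\ u \in X, v \notin X, c \notin X, c != v &
      forall x y, x \in X -> y \notin X -> e x y -> y = c \/ x = u /\ y = v].

(** Since [c] belongs to neither side, the side of [v] is what remains outside [c |: X]. *)
Lemma edge_sepC (T : finType) (e : rel T) (u v c : T) (X : {set T}) :
  symmetric e -> edge_sep e u v X c -> edge_sep e v u (~: (c |: X)) c.
Proof.
move=> esym [uX vX cX cv out]; split;
  rewrite ?inE ?uX ?eqxx ?orbT ?(negPf vX) ?orbF 1?eq_sym //.
  by apply: contraNneq cX => <-.
move=> x y; rewrite !inE negb_or negbK => /andP[xc xX] /orP[/eqP|yX exy];
  first by left.
have [xE|[-> ->]] := out _ _ yX xX (etrans (esym _ _) exy); last by right.
by rewrite xE eqxx in xc.
Qed.

(** If no vertex separated [u] from [v] once the edge is deleted, that edge could always be bypassed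
    and its deletion would keep the graph 2-connected. For a separating [c], the side [X] is the
    component of [u]. *)
Lemma edge_sep_exists (T : finType) (e : rel T) (u v : T) :
  symmetric e -> minimally_2_connected e -> e u v -> u != v ->
  exists X c, edge_sep e u v X c.
Proof.
move=> esym [conn emin] euv uv.
set d := del_edge e u v.
have dsym S : connect_sym (del_vertices d S).
  apply: sym_connect_sym => a b;
    rewrite /del_vertices /d /del_edge /= esym (setUC [set a]).
  by case: (e b a) => //=; case: (_ != _) => //=; rewrite andbC.
case: (boolP [forall c, (c != u) && (c != v) ==> connect (del_vertices d [set c]) u v]).
  move=> /forallP all_c; case: (emin _ _ euv); split; first exact: conn.1.
  move=> S S2 x y xS yS.
  have uvS : u \notin S -> v \notin S -> connect (del_vertices d S) u v.
    (* For empty [S], a path avoiding some third vertex serves as well. *)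
    move=> uS vS; have [S0|[c cS]] := set_0Vmem S.
      have [w wuv] := third_vertex u v conn.1.
      have /implyP/(_ wuv) := all_c w; apply: connect_sub => a b.
      by move=> /and3P[dab _ _]; apply: connect1;
        rewrite /del_vertices /= dab S0 !inE.
    have SE : S = [set c].
      apply/eqP; rewrite eq_sym eqEcard sub1set cS cards1.
      by move: S2; rewrite ltnS.
    rewrite SE; apply: (implyP (all_c c)).
    by apply/andP; split; [apply: contraNneq uS | apply: contraNneq vS] => <-.
  apply: connect_sub (conn.2 S S2 x y xS yS) => a b /and3P[eab aS bS].
  case: (boolP ([set a; b] == [set u; v])) => [/eqP abuv|nab]; last first.
    by apply: connect1; rewrite /del_vertices /d /del_edge /= eab nab aS bS.
  have : a \in [set u; v] by rewrite -abuv !inE eqxx.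
  have : b \in [set u; v] by rewrite -abuv !inE eqxx orbT.
  have : u \in [set a; b] by rewrite abuv !inE eqxx.
  have : v \in [set a; b] by rewrite abuv !inE eqxx orbT.
  rewrite !inE => vab uab /orP[]/eqP bE /orP[]/eqP aE; subst a b.
  - by rewrite orbb eq_sym (negPf uv) in vab.
  - by rewrite dsym; apply: uvS.
  - exact: uvS.
  - by rewrite orbb (negPf uv) in uab.
rewrite negb_forall => /existsP[c]; rewrite negb_imply => /andP[/andP[cu cv] ncuv].
have nuc : ~~ connect (del_vertices d [set c]) u c.
  apply/negP => /(@connect_exit _ _ [set~ c]) []; rewrite ?inE ?eqxx 1?eq_sym //.
  by move=> a [b []]; rewrite /del_vertices /= !inE => _ /negPn -> /and3P[].
exists [set x | connect (del_vertices d [set c]) u x], c.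
split; rewrite ?inE ?connect0 //.
move=> x y; rewrite !inE => ux uy exy.
have [->|yc] := eqVneq y c; [by left | right].
have xc : x != c by apply: contraTneq ux => ->.
case: (boolP ([set x; y] == [set u; v])) => [/eqP xyuv|nxy]; last first.
  by case/negP: uy; apply: connect_trans ux (connect1 _);
    rewrite /del_vertices /d /del_edge /= exy nxy !inE xc yc.
have xin : x \in [set u; v] by rewrite -xyuv !inE eqxx.
have yin : y \in [set u; v] by rewrite -xyuv !inE eqxx orbT.
have yu : y != u by apply: contraNneq uy => ->; exact: connect0.
have xv : x != v by apply: contraNneq ncuv => <-.
by move: xin yin; rewrite !inE (negPf yu) (negPf xv) orbF => /eqP-> /eqP->.
Qed.

(** Any separation of the edge [u1 u] works: uncrossing it with the given one forces [X1] into [X].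
    The far side below means the complement of [c |: X]. *)
Lemma edge_sep_shift (T : finType) (e : rel T) (u v u1 c : T) (X : {set T}) :
  symmetric e -> irreflexive e -> minimally_2_connected e ->
  edge_sep e u v X c -> e u v -> 2 < deg e u -> e u u1 -> u1 != v ->
  exists X1 c1, edge_sep e u1 u X1 c1 /\ X1 \subset X.
Proof.
move=> esym eirr emin [uX vX cX cv out] euv du euu1 u1v.
have conn := emin.1.
have uu1 : u1 != u by apply/eqP => E; rewrite E eirr in euu1.
have cu : c != u by apply: contraNneq cX => ->.
have uc : u != c by rewrite eq_sym.
have vc : v != c by rewrite eq_sym.
have [X1 [c1 [u1X1 uX1 c1X1 c1u out1]]] :=
  edge_sep_exists esym emin (etrans (esym _ _) euu1) uu1.
have u1Xc : (u1 \in X) || (u1 == c).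
  case: (boolP (u1 \in X)) => //= u1X; have [->|[_ E]] := out _ _ uX u1X euu1;
    first exact: eqxx.
  by rewrite E eqxx in u1v.
have outY x y : x \notin X -> x != c -> y \in X -> e x y -> y = u /\ x = v.
  move=> xX xc yX exy; have [E|//] := out _ _ yX xX (etrans (esym _ _) exy).
  by rewrite E eqxx in xc.
case: (boolP ((c1 \notin X) && (c1 != c))) => [/andP[c1X c1c]|c1Xc].
  (* Suppose [c1] is on the far side. If [c] is outside [X1], deleting [u] cuts [u1] from [c],
     because an edge from [X1 :&: X] to a vertex of [c |: X] outside [X1] must end at [c1] or
     [u]. *)
  case: (boolP (c \in X1)) => cX1; last first.
    have [||||a [b []]] := @exit_edge _ e u u1 c (X1 :&: (c |: X)) conn;
      rewrite ?inE ?(negPf uX1) ?(negPf cX1) ?u1X1 1?orbC //.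
    case/andP=> aX1 aX; rewrite negb_and => bX bu eab.
    have ac : a != c by apply: contraNneq cX1 => <-.
    rewrite orbC (negPf ac) /= in aX.
    have au : a != u by apply: contraNneq uX1 => <-.
    have bcX : (b == c) || (b \in X).
      case: (boolP (b \in X)) => bX'; rewrite ?orbT // orbF.
      have [->|[E _]] := out _ _ aX bX' eab; first exact: eqxx.
      by rewrite E eqxx in au.
    rewrite bcX orbF in bX.
    have [E|[_ E]] := out1 _ _ aX1 bX eab.
      by move: bcX; rewrite E (negPf c1c) (negPf c1X).
    by rewrite E eqxx in bu.
  (* Here degree at least 3 enters: the third neighbour [u2] lies in [X :\: X1]. With [u] deleted,
     an edge leaving this set enters [X1], so it starts at [c1], which is not in [X]. *)
  have [u2 [eu2 u2v u21]] : exists u2, [/\ e u u2, u2 != v & u2 != u1].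
    have : 0 < #|[set y | e u y] :\: [set v; u1]|.
      rewrite cardsD subn_gt0; apply: leq_ltn_trans du.
      apply: leq_trans (subset_leq_card (subsetIr _ _)) _.
      by rewrite cards2; case: eqP.
    by case/card_gt0P => w; rewrite !inE negb_or => /andP[/andP[? ?] ?]; exists w.
  have u2X1 : u2 \notin X1.
    apply/negP => u2X1; have [E|[E _]] := out1 _ _ u2X1 uX1 (etrans (esym _ _) eu2).
      by rewrite E eqxx in c1u.
    by rewrite E eqxx in u21.
  have u2u : u2 != u by apply/eqP => E; rewrite E eirr in eu2.
  have u2c : u2 != c by apply: contraNneq u2X1 => ->.
  have u2X : u2 \in X.
    apply/negPn/negP => u2X; have [E|[_ E]] := out _ _ uX u2X eu2.
      by rewrite E eqxx in u2c.
    by rewrite E eqxx in u2v.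
  have [||||a [b []]] := @exit_edge _ e u u2 u1 (X :\: X1 :\ u) conn;
    rewrite ?inE ?eqxx ?u2u ?u2X1 ?u1X1 ?andbF //.
  case/and3P=> au aX1 aX; rewrite !negb_and !negbK => bX bu eab.
  rewrite (negPf bu) /= in bX.
  have bX1 : b \in X1.
    case/orP: bX => // bX; have [->//|[E _]] := out _ _ aX bX eab.
    by rewrite E eqxx in au.
  have [E|[_ E]] := out1 _ _ bX1 aX1 (etrans (esym _ _) eab).
    by rewrite E (negPf c1X) in aX.
  by rewrite E eqxx in au.
rewrite negb_and !negbK in c1Xc.
(* With [c] deleted, an edge from the part of [X1] on the far side to a vertex outside that part is
   either the edge [v u], which the second separation forbids, or ends at [c1] or [u], neither on
   the far side. *)
have YX1 x : x \notin X -> x != c -> x \notin X1.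
  move=> xX xc; apply/negP => xX1.
  have [||||a [b []]] := @exit_edge _ e c x u (X1 :\: (c |: X)) conn;
    rewrite ?inE ?eqxx ?(negPf xX) ?(negPf xc) ?uX ?orbT //.
  rewrite negb_or => /andP[/andP[ac aX] aX1]; rewrite negb_and !negbK => bX bc eab.
  rewrite (negPf bc) /= in bX.
  case: (boolP (b \in X)) bX => bX /= bX1.
    have [bE aE] := outY _ _ aX ac bX eab; rewrite bE in eab.
    have [E|[E _]] := out1 _ _ aX1 uX1 eab; first by rewrite E eqxx in c1u.
    by rewrite -E aE eqxx in u1v.
  have [E|[_ E]] := out1 _ _ aX1 bX1 eab; last by rewrite E uX in bX.
  by move: c1Xc; rewrite -E (negPf bX) (negPf bc).
(* If [c] were in [X1], deleting [u] would cut [v] from [c]: a far-side neighbour of [c] would have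
   to be [c1] or [u]. *)
have cX1 : c \notin X1.
  apply/negP => cX1.
  have [||||a [b []]] := @exit_edge _ e u v c (~: (c |: X)) conn;
    rewrite ?inE ?eqxx ?uX ?orbT ?negb_or ?vX ?andbT //.
  case/andP=> ac aX; rewrite negb_and !negbK => bX bu eab.
  have bE : b = c.
    by case/orP: bX => [/eqP//|bX]; have [E] := outY _ _ aX ac bX eab;
      rewrite E eqxx in bu.
  rewrite bE in eab.
  have [E|[_ E]] := out1 _ _ cX1 (YX1 _ aX ac) (etrans (esym _ _) eab).
    by move: c1Xc; rewrite -E (negPf aX) (negPf ac).
  by rewrite E uX in aX.
exists X1, c1; split=> //; apply/subsetP => x xX1; apply/negPn/negP => xX.
have xc : x != c by apply: contraNneq cX1 => <-.
by have := YX1 _ xX xc; rewrite xX1.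
Qed.

(** Each step along the path shifts the separation to the edge just traversed, with a side nested in
    the previous one. *)
Lemma edge_sep_path (T : finType) (e : rel T) (F X : {set T}) (u v c : T) (p : seq T) :
  symmetric e -> irreflexive e -> minimally_2_connected e ->
  {in F, forall x, 2 < deg e x} ->
  edge_sep e u v X c -> e u v -> path [rel a b | [&& e a b, a \in F & b \in F]] u p ->
  uniq (v :: u :: p) -> last u p \in X.
Proof.
move=> esym eirr emin Fdeg; elim: p u v X c => [|u1 p IHp] u v X c /=;
  first by case.
move=> sepX euv /andP[/and3P[euu1 uF u1F] pth] /andP[].
rewrite !inE !negb_or => /and3P[_ vu1 _] /andP[/andP[uu1 up] /andP[u1p pu]].
have [|X1 [c1 [sep1 /subsetP X1X]]] :=
  edge_sep_shift esym eirr emin sepX euv (Fdeg _ uF) euu1.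
  by rewrite eq_sym.
apply/X1X/(IHp _ _ _ _ sep1) => //=; first by rewrite esym.
by rewrite !inE negb_or uu1 up u1p.
Qed.

(** * The subgraph induced by the vertices of degree at least three *)

Definition adj_in (T : finType) (e : rel T) (S : {set T}) : rel T :=
  [rel a b | [&& e a b, a \in S & b \in S]].

(* Ordered pairs are counted, so an edge inside [A :&: B] counts twice. *)
Definition edges (T : finType) (e : rel T) (A B : {set T}) : nat :=
  \sum_(x in A) \sum_(y in B) e x y.

Lemma edgesC (T : finType) (e : rel T) (A B : {set T}) :
  symmetric e -> edges e A B = edges e B A.
Proof.
move=> esym; rewrite /edges exchange_big /=.
by apply: eq_bigr => x _; apply: eq_bigr => y _; rewrite esym.
Qed.

Lemma degE (T : finType) (e : rel T) (x : T) : deg e x = \sum_y e x y.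
Proof. by rewrite /deg -sum1dep_card big_mkcond; apply: eq_bigr => y _;
  case: (e x y). Qed.

Lemma sum_deg (T : finType) (e : rel T) (A F : {set T}) :
  \sum_(x in A) deg e x = edges e A F + edges e A (~: F).
Proof.
rewrite /edges -big_split /=; apply: eq_bigr => x _.
rewrite degE (bigID (mem F)) /=; congr (_ + _).
by apply: eq_bigl => y; rewrite inE.
Qed.

Lemma edgesD1 (T : finType) (e : rel T) (S : {set T}) (x : T) :
  symmetric e -> irreflexive e -> x \in S ->
  edges e S S = edges e (S :\ x) (S :\ x) + 2 * \sum_(y in S) e x y.
Proof.
move=> esym eirr xS.
have dE : \sum_(y in S) e x y = \sum_(y in S :\ x) e y x.
  by rewrite (big_setD1 x) //= eirr add0n; apply: eq_bigr => y _; rewrite esym.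
rewrite /edges (big_setD1 x) //=.
under [X in _ + X]eq_bigr => z _ do rewrite (big_setD1 x) //=.
by rewrite big_split /= -dE addnA addnn -mul2n addnC.
Qed.

(** The hypothesis on subsets says that [F] induces a forest. As [edges] counts twice, a forest with
    k components has [edges e F F = 2 * (#|F| - k)]; the alternatives are k at least 2 and k equal
    to 1. *)
Lemma forest_edges (T : finType) (e : rel T) (F : {set T}) :
  symmetric e -> irreflexive e ->
  (forall S : {set T}, S \subset F -> S != set0 ->
     exists2 x, x \in S & \sum_(y in S) e x y <= 1) ->
  F != set0 ->
  edges e F F + 4 <= 2 * #|F| \/
  edges e F F + 2 = 2 * #|F| /\ {in F &, forall x y, connect (adj_in e F) x y}.
Proof.
move=> esym eirr; have [k] := ubnP #|F|; elim: k F => // k IHk F Fk low F0.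
have [x xF xlow] := low F (subxx F) F0.
have FE := edgesD1 esym eirr xF.
have cE := cardsD1 x F; rewrite xF in cE.
have [F'0|F'0] := eqVneq (F :\ x) set0.
  right; have -> : F = [set x] by rewrite -(setD1K xF) F'0 setU0.
  split; last by move=> a b /set1P-> /set1P->; exact: connect0.
  by rewrite /edges !big_set1 eirr cards1.
have [|||bound|[bound conn]] := IHk (F :\ x).
- by move: Fk cE; clear; lia.
- by move=> S SF; apply: low; apply: subset_trans SF (subsetDl _ _).
- by [].
- by left; move: bound xlow cE; rewrite FE; clear; lia.
(* The rest is a tree: [x] is either isolated, forming a second component, or attached by exactly
   one edge. *)
case: (posnP (\sum_(y in F) e x y)) => d0.
  by left; move: bound cE; rewrite FE d0; clear; lia.
right; split; first by move: bound xlow d0 cE; rewrite FE; clear; lia.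
have [y yF exy] : exists2 y, y \in F :\ x & e x y.
  move: d0; rewrite lt0n sum_nat_eq0 negb_forall => /existsP[y].
  rewrite negb_imply eqb0 negbK => /andP[yF exy]; exists y => //.
  by rewrite !inE yF andbT; apply: contraTneq exy => ->; rewrite eirr.
have csym : connect_sym (adj_in e F).
  by apply: sym_connect_sym => a b; rewrite /adj_in /= esym; congr (_ && _);
    rewrite andbC.
suff toy a : a \in F -> connect (adj_in e F) a y.
  by move=> a b aF bF; apply: connect_trans (toy a aF) _; rewrite csym toy.
move=> aF; have [->|ax] := eqVneq a x.
  by apply: connect1; move: yF; rewrite /adj_in /= exy xF !inE => /andP[].
have : connect (adj_in e (F :\ x)) a y by apply: conn => //; rewrite !inE ax.
apply: connect_sub => b b';
  rewrite /adj_in /= !inE => /and3P[ebb /andP[_ bF] /andP[_ bF']].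
by apply: connect1; rewrite /= ebb bF bF'.
Qed.

(** While [u] has another neighbour [u1] in [S], shift to the edge [u1 u]. The side strictly shrinks
    because it loses [u], so the walk stops at a leaf. The separation is kept for the tree case. *)
Lemma leaf_sep (T : finType) (e : rel T) (S : {set T}) (u v : T) :
  symmetric e -> irreflexive e -> minimally_2_connected e ->
  {in S, forall x, 2 < deg e x} -> u \in S -> v \in S -> e u v ->
  exists u v X c, [/\ u \in S, v \in S, e u v, edge_sep e u v X c &
                     {in S, forall y, e u y -> y = v}].
Proof.
move=> esym eirr emin Sdeg uS vS euv.
have uv : u != v by apply: contraTneq euv => ->; rewrite eirr.
have [X [c]] := edge_sep_exists esym emin euv uv.
have [k] := ubnP #|X|;
  elim: k u v X c uS vS euv {uv} => // k IHk u v X c uS vS euv Xk sepX.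
case: (boolP [exists y in S, e u y && (y != v)]); last first.
  move=> none; exists u, v, X, c; split=> // y yS euy; apply/eqP/negPn/negP => yv.
  by case/existsP: none; exists y; rewrite yS euy.
case/exists_inP => u1 u1S /andP[euu1 u1v].
have [X1 [c1 [sep1 X1X]]] :=
  edge_sep_shift esym eirr emin sepX euv (Sdeg _ uS) euu1 u1v.
apply: (IHk u1 u X1 c1) => //; first by rewrite esym.
apply: leq_trans (proper_card _) Xk; rewrite properE X1X.
by apply/subsetPn; exists u; [case: sepX | case: sep1].
Qed.

Lemma low_degree_vertex (T : finType) (e : rel T) (S : {set T}) :
  symmetric e -> irreflexive e -> minimally_2_connected e ->
  {in S, forall x, 2 < deg e x} -> S != set0 ->
  exists2 x, x \in S & \sum_(y in S) e x y <= 1.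
Proof.
move=> esym eirr emin Sdeg /set0Pn[x xS].
case: (posnP (\sum_(y in S) e x y)) => [d0|]; first by exists x; rewrite ?d0.
rewrite lt0n sum_nat_eq0 negb_forall => /existsP[y].
rewrite negb_imply eqb0 negbK => /andP[yS exy].
have [u [v [X [c [uS vS euv _ leaf]]]]] := leaf_sep esym eirr emin Sdeg xS yS exy.
exists u => //; rewrite (big_setD1 v) //= euv big1 // => z.
rewrite !inE => /andP[zv zS]; case euz: (e u z) => //.
by rewrite (leaf z zS euz) eqxx in zv.
Qed.

(* At a leaf [u] of the tree induced by [F], its two other neighbours have
   degree two and cannot both be the separating vertex; the one that is not has
   its second neighbour on the side of [u], where [u] is the only vertex of
   [F]. *)
Lemma tree_adjacent_deg2 (T : finType) (e : rel T) (F : {set T}) (x y : T) :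
  symmetric e -> irreflexive e -> minimally_2_connected e ->
  {in F, forall x, 2 < deg e x} -> (forall x, x \notin F -> deg e x = 2) ->
  {in F &, forall x y, connect (adj_in e F) x y} ->
  x \in F -> y \in F -> x != y ->
  exists w z, [/\ w \notin F, z \notin F & e w z].
Proof.
move=> esym eirr emin Fdeg Wdeg Fconn xF yF xy.
have [||a [b [_ _ /and3P[eab aF bF]]]] := connect_exit (A :=
  [set x]) (Fconn x y xF yF).
- exact: set11.
- by rewrite inE eq_sym.
have [u [v [X [c [uF vF euv sepX leaf]]]]] :=
  leaf_sep esym eirr emin Fdeg aF bF eab.
have [uX vX cX cv out] := sepX.
have uv : u != v by apply: contraTneq euv => ->; rewrite eirr.
have cu : c != u by apply: contraNneq cX => ->.
(* A path in [F] from the leaf [u] to [c] starts with [v]; by the reversed separation it then stays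
   on the side of [v], which excludes [c]. *)
have cF : c \notin F.
  apply/negP => cF; have /connectP[p0 pth0 cE] := Fconn u c uF cF.
  move: cE; case/shortenP: pth0 => [[|v' p]] //=; first by move=> _ _ _ E;
    rewrite E eqxx in cu.
  move=> /andP[/and3P[euv' _ v'F] pth] un _; have v'E := leaf v' v'F euv';
    subst v' => cE.
  have evu : e v u by rewrite esym.
  have := edge_sep_path esym eirr emin Fdeg (edge_sepC esym sepX) evu pth un.
  by rewrite -cE !inE eqxx.
(* A walk in [F] from [z] to [v] cannot leave [X :\ u]: not through [u], whose only neighbour in [F]
   is [v], nor through [c], which is not in [F]. *)
have XF z : z \in F -> z \in X -> z = u.
  move=> zF zX; apply/eqP/negPn/negP => zu.
  have [||a' [b' []]] := connect_exit (A := F :&: X :\ u) (Fconn z v zF vF).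
  - by rewrite !inE zu zF.
  - by rewrite !inE (negPf vX) !andbF.
  rewrite !inE => /and3P[au' aF' aX'] nb /and3P[eab' _ bF'].
  rewrite bF' /= negb_and negbK in nb; case/orP: nb => [/eqP bE|bX'].
    by rewrite bE esym in eab'; rewrite (leaf _ aF' eab') (negPf vX) in aX'.
  have [bE|[aE _]] := out _ _ aX' bX' eab'; first by rewrite bE (negPf cF) in bF'.
  by rewrite aE eqxx in au'.
have [w [euw wv wc]] : exists w, [/\ e u w, w != v & w != c].
  have : 0 < #|[set y | e u y] :\: [set v; c]|.
    rewrite cardsD subn_gt0; apply: leq_ltn_trans (Fdeg u uF).
    apply: leq_trans (subset_leq_card (subsetIr _ _)) _.
    by rewrite cards2; case: eqP.
  by case/card_gt0P => w; rewrite !inE negb_or => /andP[/andP[? ?] ?]; exists w.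
have wF : w \notin F by apply/negP => wF; rewrite (leaf w wF euw) eqxx in wv.
have wX : w \in X.
  apply/negPn/negP => wX; have [E|[_ E]] := out _ _ uX wX euw.
    by rewrite E eqxx in wc.
  by rewrite E eqxx in wv.
have [z ewz zu] : exists2 z, e w z & z != u.
  have : 0 < #|[set y | e w y] :\ u|.
    by have := Wdeg w wF; rewrite /deg (cardsD1 u) inE esym euw add1n => -[->].
  by case/card_gt0P => z; rewrite !inE => /andP[? ?]; exists z.
exists w, z; split=> //; apply/negP => zF.
case: (boolP (z \in X)) => zX; first by rewrite (XF z zF zX) eqxx in zu.
have [E|[E _]] := out _ _ wX zX ewz; first by rewrite E (negPf cF) in zF.
by rewrite E uF in wF.
Qed.

(** After the deletion of any other vertex, [x] still has a neighbour; deleting a first neighbour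
    yields a second. *)
Lemma deg_ge2 (T : finType) (e : rel T) (x : T) :
  irreflexive e -> k_connected 2 e -> 1 < deg e x.
Proof.
move=> eirr conn.
have nbr c : c != x -> exists2 b, e x b & b != c.
  move=> cx; have [w /andP[wx wc]] := third_vertex x c conn.1.
  have [||||a [b []]] := @exit_edge _ e c x w [set x] conn; rewrite ?inE //.
  by move=> /eqP-> _ bc exb; exists b.
have [c /andP[cx _]] := third_vertex x x conn.1.
have [b1 xb1 _] := nbr c cx.
have [|b2 xb2 b21] := nbr b1; first by apply: contraTneq xb1 => ->; rewrite eirr.
have <- : #|[set b2; b1]| = 2 by rewrite cards2 b21.
by apply/subset_leq_card/subsetP => z; rewrite !inE => /orP[]/eqP->.
Qed.

(** With W the complement of [F], the degree sum over W is 2|W|, so the sum over [F] is e(F,F) +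
    2|W| - e(W,W), where e(A,B) stands for [edges e A B]. *)
Lemma sum_big_degrees (T : finType) (e : rel T) (F : {set T}) :
  symmetric e -> irreflexive e -> minimally_2_connected e ->
  F = [set x | 2 < deg e x] -> 1 < #|F| ->
  \sum_(x in F) deg e x + 4 <= 2 * #|T|.
Proof.
move=> esym eirr emin FE F2.
have Fdeg : {in F, forall x, 2 < deg e x} by move=> x; rewrite FE inE.
have Wdeg x : x \notin F -> deg e x = 2.
  rewrite FE inE -leqNgt => d2; apply/eqP.
  by rewrite eqn_leq d2 deg_ge2 //; exact: emin.1.
have [x [y [xF yF xy]]] := card_gt1P F2.
have F0 : F != set0 by apply/set0Pn; exists x.
(* In the tree case the missing 2 comes from the edge [w z] inside the complement, counted once in
   each direction. *)
have main : edges e F F + 4 <= 2 * #|F| + edges e (~: F) (~: F).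
  have [|bound|[bound conn]] := @forest_edges _ e F esym eirr _ F0.
  - by move=> S /subsetP SF; apply: low_degree_vertex => // z /SF; apply: Fdeg.
  - exact: leq_trans bound (leq_addr _ _).
  have [w [z [wF zF ewz]]] :=
    tree_adjacent_deg2 esym eirr emin Fdeg Wdeg conn xF yF xy.
  have wz : z != w by apply: contraTneq ewz => ->; rewrite eirr.
  suff : 2 <= edges e (~: F) (~: F) by move: bound; clear; lia.
  rewrite /edges (bigD1 w) ?inE //= (bigD1 z) ?inE //= ewz.
  rewrite [X in _ + X](bigD1 z) ?inE ?zF ?wz //= [X in _ + (X + _)](bigD1 w) ?inE //= esym ewz.
  by clear; lia.
have WE : \sum_(x in ~: F) deg e x = 2 * #|~: F|.
  rewrite mulnC -sum_nat_const; apply: eq_bigr => z; rewrite inE; exact: Wdeg.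
move: WE main (cardsC F); rewrite !(sum_deg _ _ F) (edgesC (~: F) F esym).
by clear; lia.
Qed.

(** * Connectivity summed over pairs of vertices *)

Lemma kappa_pair_bound (T : finType) (e : rel T) (D : {set T * T}) (u v : T) :
  symmetric e -> orientation e D -> u != v -> 1 < deg e u -> 1 < deg e v ->
  2 * (kappa D u v + kappa D v u) <=
    4 + ((2 < deg e u) && (2 < deg e v)) * ((deg e u - 2) + (deg e v - 2)).
Proof.
move=> esym De uv.
have vu : v != u by rewrite eq_sym.
have := kappa_le_outdeg D uv; have := kappa_le_outdeg D vu.
have := kappa_le_indeg D uv; have := kappa_le_indeg D vu.
rewrite -(orientation_degree u esym De) -(orientation_degree v esym De).
(* If one degree is 2, the in- and outdegree of that vertex bound the two terms and add up to 2.
   Otherwise all four bounds are added. *)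
by clear; case: (ltnP 2 _) => ?; case: (ltnP 2 _) => ? /=; lia.
Qed.

Lemma sum_offdiag (T : finType) (f : T -> T -> nat) :
  \sum_(uv : T * T | uv.1 != uv.2) f uv.1 uv.2 = \sum_u \sum_(v | u != v) f u v.
Proof. by rewrite pair_big_dep. Qed.

Lemma sum_offdiagC (T : finType) (f : T -> T -> nat) :
  \sum_u \sum_(v | u != v) f v u = \sum_u \sum_(v | u != v) f u v.
Proof.
rewrite (exchange_big_dep predT) //=; apply: eq_bigr => u _.
by apply: eq_bigl => v; rewrite eq_sym.
Qed.

(** Each member of [F] meets [#|F|.-1] others, once as first and once as second coordinate. *)
Lemma sum_offdiag_in (T : finType) (F : {set T}) (g : T -> nat) :
  \sum_u \sum_(v | u != v) ((u \in F) && (v \in F)) * (g u + g v) =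
  2 * (#|F|.-1 * \sum_(u in F) g u).
Proof.
have half : \sum_u \sum_(v | u != v) ((u \in F) && (v \in F)) * g u =
    #|F|.-1 * \sum_(u in F) g u.
  rewrite big_distrr /= [RHS]big_mkcond /=; apply: eq_bigr => u _.
  case: ifP => uF; last by rewrite big1.
  rewrite -big_distrl /=; congr (_ * _).
  rewrite (cardsD1 u F) uF /= -sum1_card big_mkcond [RHS]big_mkcond /=.
  by apply: eq_bigr => v _; rewrite !inE eq_sym; case: (_ == _) => //=;
    case: (v \in F).
rewrite mul2n -addnn -{1}half -half -[X in _ = _ + X]sum_offdiagC -big_split /=.
apply: eq_bigr => u _; rewrite -big_split /=; apply: eq_bigr => v _.
by rewrite mulnDr [(v \in F) && _]andbC.
Qed.

Lemma sum_kappa_bound (T : finType) (e : rel T) (D : {set T * T}) :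
  simple_graph e -> minimally_2_connected e -> orientation e D ->
  4 * \sum_(uv : T * T | uv.1 != uv.2) kappa D uv.1 uv.2 <=
    4 * (#|T| * #|T|.-1) + (#|T| - 3) ^ 2.
Proof.
move=> [esym eirr] emin De.
pose F := [set x | 2 < deg e x].
have d2 x : 1 < deg e x by apply: deg_ge2 => //; exact: emin.1.
have n3 : 2 < #|T| := emin.1.1.
have offcard : \sum_(u : T) \sum_(v | u != v) 4 = 4 * (#|T| * #|T|.-1).
  have inner (u : T) : \sum_(v | u != v) 4 = #|T|.-1 * 4.
    rewrite sum_nat_const; congr (_ * _); rewrite -(cardC1 u).
    by apply: eq_card => v; rewrite !inE eq_sym.
  by rewrite (eq_bigr _ (fun u _ => inner u)) sum_nat_const mulnA mulnC.
have excess : 2 * (#|F|.-1 * \sum_(u in F) (deg e u - 2)) <= (#|T| - 3) ^ 2.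
  have [F2|F1] := ltnP 1 #|F|; last by have -> : #|F|.-1 = 0 by move: F1; clear;
    lia.
  have := sum_big_degrees esym eirr emin (erefl F) F2.
  have -> : \sum_(x in F) deg e x = \sum_(x in F) (deg e x - 2) + #|F| * 2.
    rewrite -sum_nat_const -big_split /=; apply: eq_bigr => x _.
    by rewrite subnK.
  set s := \sum_(x in F) _; move: #|F| #|T| F2 => f n F2 bound.
  have {}bound : s <= 2 * (n - f - 2) by move: bound; clear; lia.
  (* If the truncated [n - f - 2] is 0, so is [s]. Otherwise 4xy <= (x + y)^2 is used with x = n - f
     - 2 and y = f - 1, whose sum is n - 3. *)
  have [nf|nf] := leqP (n - f) 2.
    by have -> : s = 0; [move: bound nf; clear; lia | rewrite !muln0].
  have -> : n - 3 = (n - f - 2) + f.-1 by move: F2 nf; clear; lia.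
  apply: leq_trans (nat_AGM2 _ _).1; rewrite mulnCA.
  by apply: leq_trans (leq_mul (leqnn _) (leq_mul (leqnn 2) bound)) _; clear; lia.
rewrite sum_offdiag.
(* Symmetrising over the two orders of a pair produces the form that [kappa_pair_bound] bounds. *)
have -> : 4 * \sum_u \sum_(v | u != v) kappa D u v =
    \sum_u \sum_(v | u != v) 2 * (kappa D u v + kappa D v u).
  rewrite (_ : 4 = 2 * 2) // -mulnA [X in 2 * X]mul2n -addnn.
  rewrite -{2}sum_offdiagC -big_split big_distrr /=; apply: eq_bigr => u _.
  by rewrite -big_split big_distrr.
rewrite -offcard; apply: leq_trans (leq_add (leqnn _) excess).
rewrite -sum_offdiag_in -big_split /=; apply: leq_sum => u _.
rewrite -big_split /=; apply: leq_sum => v uv.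
by rewrite !inE; apply: kappa_pair_bound.
Qed.

(** * Passage to rational averages *)

Import Order.TTheory GRing.Theory Num.Theory.
Local Open Scope ring_scope.

Theorem theorem4p6 (T : finType) (e : rel T) (n : nat)
    (Ge : simple_graph e) (Tn : #|T| = n) (n3 : (3 <= n)%N)
    (Gmin : minimally_2_connected e) :
  [/\ 1 <= max_avg_kappa e,
      max_avg_kappa e <= 1 + (n%:R - 3) ^+ 2 / (4 * n%:R * (n%:R - 1))
    & 1 + (n%:R - 3) ^+ 2 / (4 * n%:R * (n%:R - 1)) < 5 / 4 :> rat].
Proof.
have [[D De DE] maxD] := max_avg_kappaP Ge.
have nR : 3 <= n%:R :> rat by rewrite ler_nat.
have nn : 0 < n%:R * (n%:R - 1) :> rat by nra.
have nnE : (n * n.-1)%:R = n%:R * (n%:R - 1) :> rat.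
  by rewrite natrM -subn1 natrB //; exact: leq_trans n3.
have pos4 : 0 < 4 * n%:R * (n%:R - 1) :> rat by nra.
split.
- have [D0 D0e strong0] := strong_orientation Ge Gmin.1.
  apply: le_trans (maxD D0 D0e);
    rewrite /avg_kappa Tn ler_pdivlMr // mul1r -nnE ler_nat.
  rewrite sum_offdiag -Tn -sum_nat_const; apply: leq_sum => u _.
  rewrite -(cardC1 u) -sum1_card;
    rewrite [X in (X <= _)%N](eq_bigl (fun v => u != v)).
    by apply: leq_sum => v _; apply: kappa_gt0.
  by move=> v; rewrite !inE eq_sym.
- rewrite -DE /avg_kappa Tn ler_pdivrMr //.
  have := sum_kappa_bound Ge Gmin De; rewrite Tn.
  set s := (\sum_(uv | _) _)%N => bound.
  have : (4 * s)%:R <= (4 * (n * n.-1) + (n - 3) ^ 2)%:R :> rat by rewrite ler_nat.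
  rewrite natrD natrX natrM [X in X + _]natrM nnE.
  (* Since [3 <= n], the truncated difference agrees with the rational one. *)
  rewrite natrB // => {}bound.
  rewrite mulrDl mul1r.
  have -> : (n%:R - 3) ^+ 2 / (4 * n%:R * (n%:R - 1)) * (n%:R * (n%:R - 1))
     = (n%:R - 3) ^+ 2 / 4 :> rat.
    by field; apply/andP; split; apply/eqP; nra.
  by lra.
(* This amounts to (n - 3)^2 < n(n - 1), that is, 9 < 5n. *)
- rewrite -ltrBrDl ltr_pdivrMr //; nra.
Qed.
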